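(* Let $v,k,r,w,n$ be positive integers. If there exists a shiftable $(v,k;r)$ Heffter space and there exists a $(w,n;r)$ space, then there exists a shiftable $(vw,kn;r)$ Heffter space.
   Context: For integers $a\le b$, $[a,b]$ denotes the set of integers $x$ with $a\le x\le b$. A $(v,k;r)$ space is a resolvable $(v_r,b_k)$ configuration with $b=\frac{vr}{k}$: a point-block incidence structure $(V,\mathcal B)$ with $|V|=v$ points, each lying in exactly $r$ blocks, and $b$ blocks, each a subset of $V$ of size $k$, such that any two distinct points lie together in at most one block, and such that $\mathcal B$ can be partitioned into parallel classes, each of which is a partition of $V$. Equivalently, it is given by a collection (called a resolution) of $r$ mutually orthogonal partitions of a $v$-set $V$ into subsets of size $k$, where two partitions $\mathcal P,\mathcal Q$ of $V$ are orthogonal if every part of $\mathcal P$ has at most one element in common with every part of $\mathcal Q$. Block size $k=1$ is allowed: the unique $(v,1;r)$ space on $V$ has as resolution the partition of $V$ into singletons repeated $r$ times (this is the only case in which repeated blocks occur). For $r=1$, a $(v,k;1)$ space is just a partition of a $v$-set into subsets of size $k$. A half-set of $[-v,v]$ is a subset $V\subseteq[-v,v]$ such that $V$ and $-V$ form a partition of $[-v,v]\setminus\{0\}$. An integer $(v,k;r)$ Heffter space is a $(v,k;r)$ space whose point set is a half-set of $[-v,v]$ and each of whose blocks has elements summing to $0$ in $\mathbb Z$. It is called shiftable if $k$ is even and each block contains exactly $\frac{k}{2}$ positive elements. A shiftable Heffter space is always understood to be integer. *)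

(* Defs.v *)
From mathcomp Require Import all_boot all_order all_algebra.
From mathcomp Require Import finmap.
Set Implicit Arguments.
Unset Strict Implicit.
Unset Printing Implicit Defensive.
Import Order.TTheory GRing.Theory Num.Theory.
Local Open Scope fset_scope.
Local Open Scope ring_scope.

(* Block collections are sequences read as multisets: repeated blocks count
   with multiplicity, as is needed for block size 1. *)
Definition configuration (T : choiceType) (V : {fset T}) (B : seq {fset T})
    (v r b k : nat) : Prop :=
  [/\ #|` V| = v,
      size B = b,
      forall X : {fset T}, X \in B -> X `<=` V /\ #|` X| = k,
      forall x : T, x \in V -> count (fun X : {fset T} => x \in X) B = r
    & forall x y : T, x \in V -> y \in V -> x != y ->
        (count (fun X : {fset T} => (x \in X) && (y \in X)) B <= 1)%N].

Definition is_partition (T : choiceType) (P : {fset {fset T}}) (V : {fset T})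
    : Prop :=
  [/\ fcover P = V, trivIfset P & fset0 \notin P].

Definition resolvable (T : choiceType) (V : {fset T}) (B : seq {fset T})
    : Prop :=
  exists Ps : seq {fset {fset T}},
    (forall P : {fset {fset T}}, P \in Ps -> is_partition P V) /\
    perm_eq B (flatten [seq enum_fset P | P <- Ps]).

Definition is_space (T : choiceType) (V : {fset T}) (B : seq {fset T})
    (v k r : nat) : Prop :=
  exists b : nat,
    [/\ (b * k = v * r)%N, configuration V B v r b k & resolvable V B].

Definition zinterval (a b : int) : {fset int} :=
  [fset x in [seq a + i%:Z | i <- iota 0 `|b - a|%N.+1] | x <= b].

Lemma in_zinterval (a b x : int) : (x \in zinterval a b) = (a <= x <= b).
Proof.
have -> : (x \in zinterval a b) =
    (x \in [seq a + i%:Z | i <- iota 0 `|b - a|%N.+1]) && (x <= b).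
  by rewrite !inE.
have [le_b|_] := boolP (x <= b); rewrite ?andbT ?andbF //.
apply/mapP/idP => [[i _ ->]|le_a]; first by rewrite lerDl.
have ge0 : 0 <= x - a by rewrite subr_ge0.
have xaE : `|x - a|%N%:Z = x - a by rewrite gez0_abs.
exists `|x - a|%N; last by rewrite xaE addrC subrK.
rewrite mem_iota /= add0n ltnS -lez_nat xaE gez0_abs ?lerD2r //.
by rewrite subr_ge0 (le_trans le_a).
Qed.

Definition negset (V : {fset int}) : {fset int} := [fset - x | x in V].

Definition half_set (v : nat) (V : {fset int}) : Prop :=
  [/\ V `<=` zinterval (- v%:Z) v%:Z,
      [disjoint V & negset V]%fset
    & V `|` negset V = zinterval (- v%:Z) v%:Z `\ 0].

Definition integer_heffter_space (V : {fset int}) (B : seq {fset int})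
    (v k r : nat) : Prop :=
  [/\ is_space V B v k r,
      half_set v V
    & forall X : {fset int}, X \in B -> \sum_(x <- X) x = 0].

Definition shiftable_heffter_space (V : {fset int}) (B : seq {fset int})
    (v k r : nat) : Prop :=
  [/\ integer_heffter_space V B v k r,
      ~~ odd k
    & forall X : {fset int}, X \in B -> #|` [fset x in X | 0 < x]| = k./2].

(* Main.v *)
Require Import Defs.
From mathcomp Require Import all_boot all_order all_algebra.
From mathcomp Require Import finmap zify.

(** Let V be the point set of the Heffter space and identify W with
    {0, ..., w-1}. The map (x, i) |-> x + sgn(x) v i is injective on V x W and
    sends it onto a half-set of [-vw, vw]. Pairing the a-th parallel class of
    the first space with the a-th one of the second, and replacing each pair of
    blocks (X, Y) by the image of X x Y, gives r mutually orthogonal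
    partitions. The image of X x Y sums to |Y| (sum of X) + v (sum of Y)
    (sum of sgn over X); the first term vanishes because X sums to 0, the
    second because X has as many positive as negative elements. Signs are
    preserved, so the new blocks are balanced too. *)

Set Implicit Arguments.
Unset Strict Implicit.
Unset Printing Implicit Defensive.
Import Order.TTheory GRing.Theory Num.Theory.
Local Open Scope fset_scope.

Lemma mem_zip (A B : eqType) (s : seq A) (t : seq B) p :
  size s = size t -> p \in zip s t -> p.1 \in s /\ p.2 \in t.
Proof.
move=> st pst; split.
- by rewrite -(@unzip1_zip _ _ s t) ?st // map_f.
- by rewrite -(@unzip2_zip _ _ s t) ?st // map_f.
Qed.

Lemma sub_in_count (A : eqType) (a b : pred A) (s : seq A) :
  {in s, forall x, a x -> b x} -> (count a s <= count b s)%N.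
Proof.
move=> sub; rewrite (@eq_in_count _ a (predI a b)); last first.
  by move=> x /sub; rewrite /=; case: (a x) => // ->.
by apply: sub_count => x /andP[].
Qed.

(** * Resolvable spaces as sequences of parallel classes *)

Section Resolution.
Variable T : choiceType.
Implicit Types (V X Y : {fset T}) (P : {fset {fset T}}).

Lemma is_partitionP P V :
  is_partition P V <->
  [/\ forall X, X \in P -> X `<=` V /\ X != fset0,
      forall x, x \in V -> exists2 X, X \in P & x \in X
    & forall X Y x, X \in P -> Y \in P -> x \in X -> x \in Y -> X = Y].
Proof.
split=> [[<- /trivIfsetP disjP P0]|[sub cov uniqP]].
  split=> [X XP|x /bigfcupP[X]|X Y x XP YP xX xY].
  - by split; [exact: bigfcup_sup|apply: contraNneq P0 => <-].
  - by rewrite andbT; exists X.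
  - apply: contraTeq xY => /(disjP _ _ XP YP) /fdisjointP; exact.
split.
- apply/fsetP => x; apply/bigfcupP/idP => [[X]|/cov[X XP xX]].
    by rewrite andbT => /sub[/fsubsetP sXV _] /sXV.
  by exists X; rewrite ?XP.
- apply/trivIfsetP => X Y XP YP; apply: contraNT => XY.
  have /fset0Pn[x] : X `&` Y != fset0 by rewrite fsetI_eq0.
  by rewrite inE => /andP[xX xY]; rewrite (uniqP X Y x).
- by apply/negP => /sub[_ /eqP].
Qed.

(* For x = y this says that some block of P contains x, so one counting lemma
   yields both the degree condition and the linearity condition. *)
Definition collinear P (x y : T) : bool :=
  has (fun X : {fset T} => (x \in X) && (y \in X)) P.

(** Two blocks of [P] through [x] coincide, and a finite set lists each block once, so the count is
    0 or 1. *)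
Lemma count_collinear P V x y : is_partition P V ->
  count (fun X : {fset T} => (x \in X) && (y \in X)) P = collinear P x y.
Proof.
move=> /is_partitionP[_ _ uniqP]; rewrite /collinear has_count.
suff : (count (fun X : {fset T} => (x \in X) && (y \in X)) P <= 1)%N by lia.
rewrite -size_filter; set s := filter _ _.
have : uniq s by rewrite filter_uniq ?fset_uniq.
have sub X : X \in s -> X \in P /\ x \in X.
  by rewrite mem_filter => /andP[/andP[]].
case: s sub => [|X [|Y s]] //= sub /andP[/negP[]].
have [XP xX] := sub X (mem_head _ _).
have [|YP yY] := sub Y; first by rewrite !inE eqxx orbT.
by rewrite (uniqP X Y x) ?mem_head.
Qed.

Lemma collinearxx P V x : is_partition P V -> x \in V -> collinear P x x.
Proof.
by move=> /is_partitionP[_ cov _] /cov[X XP xX]; apply/hasP; exists X; rewrite ?xX.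
Qed.

(** Orthogonality is expressed pointwise: two distinct points share a block in at most one class.
    The classes form a sequence because for block size 1 the singleton partition occurs [r]
    times. *)
Definition resolution V (Ps : seq {fset {fset T}}) (v k r : nat) : Prop :=
  [/\ #|` V| = v,
      size Ps = r,
      forall P, P \in Ps -> is_partition P V,
      forall P X, P \in Ps -> X \in P -> #|` X| = k
    & forall x y, x \in V -> y \in V -> x != y ->
        (count (fun P => collinear P x y) Ps <= 1)%N].

Lemma count_flatten_collinear V (Ps : seq {fset {fset T}}) x y :
  (forall P, P \in Ps -> is_partition P V) ->
  count (fun X : {fset T} => (x \in X) && (y \in X))
        (flatten [seq enum_fset P | P <- Ps])
  = count (fun P => collinear P x y) Ps.
Proof.
elim: Ps => //= P Ps IH partP; rewrite count_cat IH => [|Q QPs].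
  by rewrite (@count_collinear P V) //; apply: partP; exact: mem_head.
by apply: partP; rewrite inE QPs orbT.
Qed.

Lemma mem_flatten_enum (Ps : seq {fset {fset T}}) X :
  reflect (exists2 P, P \in Ps & X \in P)
          (X \in flatten [seq enum_fset P | P <- Ps]).
Proof.
apply: (iffP flattenP) => [[_ /mapP[P PPs ->] XP]|[P PPs XP]]; first by exists P.
by exists (enum_fset P); rewrite ?map_f.
Qed.

(** The link with [B] is kept in the conclusion because the sum and sign conditions of a Heffter
    space are stated on the blocks of [B]. *)
Lemma space_resolution V (B : seq {fset T}) v k r : (0 < v)%N ->
  is_space V B v k r ->
  exists2 Ps, resolution V Ps v k r
    & perm_eq B (flatten [seq enum_fset P | P <- Ps]).
Proof.
move=> v_gt0 [b [_ [cardV _ blk deg lin] [Ps [partP permB]]]].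
exists Ps => //; split=> //.
(* The number of classes is the degree of any one point, since each class has exactly one block
   through it; [0 < v] supplies such a point. Here [andbb] turns the degree into the diagonal case
   of the pair count. *)
- have /fset0Pn[x xV] : V != fset0 by rewrite -cardfs_gt0 cardV.
  rewrite -(deg x xV) -(eq_count (fun X => andbb (x \in X))) (permP permB).
  rewrite (count_flatten_collinear _ _ partP).
  by apply/esym/eqP; rewrite -all_count; apply/allP => P /partP /collinearxx; exact.
- move=> P X PPs XP; suff /blk[] : X \in B by [].
  by rewrite (perm_mem permB); apply/mem_flatten_enum; exists P.
- move=> x y xV yV xy.
  by rewrite -(count_flatten_collinear _ _ partP) -(permP permB) lin.
Qed.

Lemma resolution_space V (Ps : seq {fset {fset T}}) v k r :
  resolution V Ps v k r ->
  is_space V (flatten [seq enum_fset P | P <- Ps]) v k r.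
Proof.
move=> [cardV sizePs partP cardX lin].
set B := flatten _.
exists (size B); split; last by exists Ps.
- rewrite /B -sizePs; clear B sizePs lin; elim: Ps partP cardX => [|P Ps IH] partP cardX.
    by rewrite muln0.
  rewrite /= size_cat mulnDl mulnS IH => [|Q QPs|Q X QPs].
  (* One class contributes [v]: its blocks are disjoint with union [V], so their sizes, all equal to
     [k], add up to [v]. *)
  + congr addn; have [covP triv _] := partP P (mem_head _ _).
    rewrite -cardV -covP -(eqP triv) -sum1_size big_distrl /=.
    rewrite big_seq [RHS]big_seq; apply: eq_bigr => X XP.
    by rewrite mul1n (cardX P) ?mem_head.
  + by apply: partP; rewrite inE QPs orbT.
  + by apply: cardX; rewrite inE QPs orbT.
split=> // [X /mem_flatten_enum[P PPs XP]|x xV|x y xV yV xy].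
- have /is_partitionP[sub _ _] := partP P PPs.
  by split; [case: (sub X XP)|exact: cardX XP].
- rewrite -(eq_count (fun X => andbb (x \in X))).
  rewrite (count_flatten_collinear _ _ partP) -sizePs.
  by apply/eqP; rewrite -all_count; apply/allP => P /partP /collinearxx; exact.
- by rewrite (count_flatten_collinear _ _ partP) lin.
Qed.

End Resolution.

(** * Product of two resolutions along a map injective on [V] x [W] *)

Section Product.
Variables T U S : choiceType.
Variables (V : {fset T}) (W : {fset U}) (f : T -> U -> S).
Hypothesis inj_f : forall x y i j, x \in V -> y \in V -> i \in W -> j \in W ->
  f x i = f y j -> x = y /\ i = j.
Implicit Types (X : {fset T}) (Y : {fset U}) (P : {fset {fset T}})
  (Q : {fset {fset U}}).

Definition prod_block X Y : {fset S} := [fset f x i | x in X, i in Y].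

Definition prod_class P Q : {fset {fset S}} :=
  [fset prod_block X Y | X in P, Y in Q].

Lemma prod_blockP X Y z :
  reflect (exists x i, [/\ x \in X, i \in Y & z = f x i]) (z \in prod_block X Y).
Proof.
apply: (iffP (imfset2P _ _ _ _ _)) => [[x xX [i iY ->]]|[x [i [xX iY ->]]]].
  by exists x, i.
by exists x => //; exists i.
Qed.

Lemma prod_classP P Q Z :
  reflect (exists X Y, [/\ X \in P, Y \in Q & Z = prod_block X Y])
          (Z \in prod_class P Q).
Proof.
apply: (iffP (imfset2P _ _ _ _ _)) => [[x xX [i iY ->]]|[x [i [xX iY ->]]]].
  by exists x, i.
by exists x => //; exists i.
Qed.

Lemma mem_prod_block X Y x i : X `<=` V -> Y `<=` W -> x \in V -> i \in W ->
  (f x i \in prod_block X Y) = (x \in X) && (i \in Y).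
Proof.
move=> /fsubsetP sXV /fsubsetP sYW xV iW.
apply/prod_blockP/andP => [[y [j [yX jY /inj_f[]]]]|[xX iY]]; last by exists x, i.
- by [].
- exact: sXV.
- by [].
- exact: sYW.
- by move=> -> ->.
Qed.

Lemma big_prod_block (R : Type) (idx : R) (op : Monoid.com_law idx) X Y
    (F : S -> R) : X `<=` V -> Y `<=` W ->
  \big[op/idx]_(z <- prod_block X Y) F z
  = \big[op/idx]_(x <- X) \big[op/idx]_(i <- Y) F (f x i).
Proof.
move=> /fsubsetP sXV /fsubsetP sYW; rewrite /prod_block big_imfset2 //=.
move=> [x i] [y j]; rewrite !inE /= => /andP[/sXV xV /sYW iW] /andP[/sXV yV /sYW jW].
by move=> /inj_f[] // -> ->.
Qed.

Lemma card_prod_block X Y : X `<=` V -> Y `<=` W ->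
  #|` prod_block X Y| = (#|` X| * #|` Y|)%N.
Proof.
move=> sXV sYW; rewrite -[LHS]sum1_size big_prod_block //= -(sum1_size X) big_distrl.
by apply: eq_bigr => x _ /=; rewrite mul1n sum1_size.
Qed.

Lemma prod_class_partition P Q : is_partition P V -> is_partition Q W ->
  is_partition (prod_class P Q) (prod_block V W).
Proof.
move=> /is_partitionP[subP covP uniqP] /is_partitionP[subQ covQ uniqQ].
apply/is_partitionP; split.
- move=> _ /prod_classP[X [Y [/subP[sXV X0] /subQ[sYW Y0] ->]]]; split.
    apply/fsubsetP => _ /prod_blockP[x [i [xX iY ->]]].
    by rewrite mem_prod_block ?fsubset_refl ?(fsubsetP sXV) ?(fsubsetP sYW).
  by rewrite -cardfs_gt0 card_prod_block // muln_gt0 !cardfs_gt0 X0.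
- move=> _ /prod_blockP[x [i [/covP[X XP xX] /covQ[Y YQ iY] ->]]].
  exists (prod_block X Y); first by apply/prod_classP; exists X, Y.
  by apply/prod_blockP; exists x, i.
- move=> _ _ z /prod_classP[X [Y [XP YQ ->]]] /prod_classP[X' [Y' [XP' YQ' ->]]].
  have [[sXV _] [sYW _]] := (subP X XP, subQ Y YQ).
  have [[sXV' _] [sYW' _]] := (subP X' XP', subQ Y' YQ').
  move=> /prod_blockP[x [i [xX iY ->]]].
  rewrite mem_prod_block ?(fsubsetP sXV) ?(fsubsetP sYW) // => /andP[xX' iY'].
  by rewrite (uniqP X X' x) // (uniqQ Y Y' i).
Qed.

Lemma collinear_prod_class P Q x y i j :
  is_partition P V -> is_partition Q W ->
  x \in V -> y \in V -> i \in W -> j \in W ->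
  collinear (prod_class P Q) (f x i) (f y j) ->
  collinear P x y && collinear Q i j.
Proof.
move=> /is_partitionP[subP _ _] /is_partitionP[subQ _ _] xV yV iW jW.
move=> /hasP[_ /prod_classP[X [Y [XP YQ ->]]]].
have [[sXV _] [sYW _]] := (subP X XP, subQ Y YQ).
rewrite !mem_prod_block // => /andP[/andP[xX iY] /andP[yX jY]].
by apply/andP; split; apply/hasP; [exists X|exists Y]; rewrite ?xX ?iY.
Qed.

Definition prod_resolution (Ps : seq {fset {fset T}}) (Qs : seq {fset {fset U}}) :=
  [seq prod_class PQ.1 PQ.2 | PQ <- zip Ps Qs].

(** For linearity, distinct product points differ in some coordinate. A paired class joining them
    has its component in that factor joining the two coordinates, which happens for at most one
    index. *)
Lemma resolution_prod Ps Qs v w k n r :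
  resolution V Ps v k r -> resolution W Qs w n r ->
  resolution (prod_block V W) (prod_resolution Ps Qs) (v * w) (k * n) r.
Proof.
move=> [cardV sizeP partP cardP linP] [cardW sizeQ partQ cardQ linQ].
have sizePQ : size Ps = size Qs by rewrite sizeQ.
split.
- by rewrite card_prod_block ?fsubset_refl // cardV cardW.
- by rewrite size_map size_zip sizeP sizeQ minnn.
- move=> _ /mapP[PQ /(mem_zip sizePQ)[/partP PV /partQ QW] ->].
  exact: prod_class_partition.
- move=> _ Z /mapP[PQ /(mem_zip sizePQ)[PPs QQs] ->].
  move=> /prod_classP[X [Y [XP YQ ->]]].
  have /is_partitionP[/(_ X XP)[sXV _] _ _] := partP _ PPs.
  have /is_partitionP[/(_ Y YQ)[sYW _] _ _] := partQ _ QQs.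
  by rewrite card_prod_block // (cardP _ _ PPs) // (cardQ _ _ QQs).
move=> _ _ /prod_blockP[x [i [xV iW ->]]] /prod_blockP[y [j [yV jW ->]]] neq.
rewrite count_map.
have coll : {in zip Ps Qs, forall PQ,
    collinear (prod_class PQ.1 PQ.2) (f x i) (f y j) ->
    collinear PQ.1 x y && collinear PQ.2 i j}.
  move=> PQ /(mem_zip sizePQ)[/partP PV /partQ QW].
  exact: collinear_prod_class.
have [xy|xy] := eqVneq x y; last first.
  apply: leq_trans (linP x y xV yV xy).
  (* Writing [Ps] as the first projection of the zip puts both counts over the same sequence of
     pairs. *)
  rewrite -[in leqRHS](@unzip1_zip _ _ Ps Qs) ?sizePQ // count_map.
  by apply: sub_in_count => PQ /coll /= H /H /andP[].
have ij : i != j by apply: contraNneq neq => <-; rewrite xy.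
apply: leq_trans (linQ i j iW jW ij).
rewrite -[in leqRHS](@unzip2_zip _ _ Ps Qs) ?sizePQ // count_map.
by apply: sub_in_count => PQ /coll /= H /H /andP[].
Qed.

End Product.

Local Open Scope ring_scope.

(** * Half-sets and the sign-preserving shift *)

Lemma mem_negset (V : {fset int}) z : (z \in negset V) = (- z \in V).
Proof.
apply/imfsetP/idP => /= [[x xV ->]|zV]; first by rewrite opprK.
by exists (- z); rewrite ?opprK.
Qed.

Lemma half_setP v (V : {fset int}) :
  half_set v V <->
  [/\ forall x, x \in V -> x != 0 /\ `|x| <= v%:Z,
      forall x, x \in V -> - x \notin V
    & forall z, z != 0 -> `|z| <= v%:Z -> (z \in V) || (- z \in V)].
Proof.
split=> [[_ /fdisjointP dis /fsetP cov]|[bnd dis cov]].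
  have {}cov z : (z \in V) || (- z \in V) = (z != 0) && (`|z| <= v%:Z).
    by move: (cov z); rewrite in_fsetU in_fsetD1 mem_negset in_zinterval ler_norml.
  split=> [x xV|x /dis|z z0 zv]; last by rewrite cov z0.
    by move: (cov x); rewrite xV => /esym/andP.
  by rewrite mem_negset.
split.
- by apply/fsubsetP => x /bnd[_]; rewrite in_zinterval ler_norml.
- by apply/fdisjointP => x /dis; rewrite mem_negset.
- apply/fsetP => z.
  rewrite in_fsetU in_fsetD1 mem_negset in_zinterval -ler_norml.
  apply/orP/andP => [[/bnd[]|/bnd[]]|[z0 zv]] //; last exact/orP/cov.
  by rewrite oppr_eq0 normrN.
Qed.

(** Moves [x] away from 0, carrying the absolute values 1, ..., v to vi+1, ..., vi+v. For i = 0,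
    ..., w-1 these windows tile 1, ..., vw. *)
Definition zshift (v : nat) (x : int) (i : nat) : int :=
  x + Num.sg x * (v * i)%N%:Z.

Lemma zshiftN v x i : zshift v (- x) i = - zshift v x i.
Proof. by rewrite /zshift sgrN mulNr opprD. Qed.

Lemma zshift_sgnorm v x i : zshift v x i = Num.sg x * (`|x| + (v * i)%N%:Z).
Proof. by rewrite /zshift mulrDr -numEsg. Qed.

Lemma normr_zshift v x i : x != 0 -> `|zshift v x i| = `|x| + (v * i)%N%:Z.
Proof.
move=> x0; rewrite zshift_sgnorm normrM normr_sg x0 mul1r ger0_norm //.
Qed.

Lemma sgr_zshift v x i : x != 0 -> Num.sg (zshift v x i) = Num.sg x.
Proof.
move=> x0; rewrite zshift_sgnorm sgrM sgr_id (@gtr0_sg _ (`|x| + _)) ?mulr1 //.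
by rewrite ltr_wpDr // normr_gt0.
Qed.

Lemma zshift_inj v x y i j : x != 0 -> y != 0 ->
  `|x| <= v%:Z -> `|y| <= v%:Z -> zshift v x i = zshift v y j ->
  x = y /\ i = j.
Proof.
move=> x0 y0 xv yv eq_xy.
have eq_sg : Num.sg x = Num.sg y by rewrite -(sgr_zshift v i x0) eq_xy sgr_zshift.
have : `|x| + (v * i)%N%:Z = `|y| + (v * j)%N%:Z.
  by rewrite -!normr_zshift // eq_xy.
have x1 : 1 <= `|x| by rewrite -gtz0_ge1 normr_gt0.
have y1 : 1 <= `|y| by rewrite -gtz0_ge1 normr_gt0.
move=> eq_norm.
(* Both absolute values lie between 1 and [v], so they differ by less than [v], whereas distinct
   indices would force a difference of at least [v]. *)
have ij : i = j by nia.
split=> //; rewrite (numEsg x) (numEsg y) eq_sg; congr (_ * _).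
by move: eq_norm; rewrite ij => /addIr.
Qed.

Lemma zshift_surj v w z : z != 0 -> `|z| <= (v * w)%N%:Z ->
  exists x i, [/\ x != 0, `|x| <= v%:Z, (i < w)%N & z = zshift v x i].
Proof.
(* Absolute values start at 1 and remainders at 0, so the division by [v] is applied to |z| - 1: the
   quotient is the index, the remainder plus 1 is the absolute value of [x]. *)
move=> z0 zvw; pose m := (`|z|.-1)%N.
have mvw : (m < v * w)%N by rewrite /m; lia.
have v_gt0 : (0 < v)%N by case: (v) mvw.
have sg_neq0 : Num.sg z != 0 by rewrite sgr_eq0.
exists (Num.sg z * (m %% v)%N.+1%:Z), (m %/ v)%N; split.
- by rewrite mulf_neq0.
- by rewrite normrM normr_sg z0 mul1r lez_nat ltn_mod.
- by rewrite ltn_divLR // mulnC.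
- rewrite zshift_sgnorm sgrM sgr_id (@gtr0_sg _ (Posz _)) // mulr1 normrM normr_sg z0 mul1r.
  rewrite [LHS]numEsg; congr (_ * _).
  have := divn_eq m v; rewrite /m; lia.
Qed.

(** * Balanced blocks and the new point set *)

Lemma sum_sgr_balanced (X : {fset int}) k : ~~ odd k -> #|` X| = k ->
  0 \notin X -> #|` [fset x in X | 0 < x]| = k./2 ->
  \sum_(x <- X) Num.sg x = 0.
Proof.
move=> evk cardX X0 pos.
(* For nonzero x the sign is 2[0 < x] - 1, so the total is 2(k/2) - k, which is 0 for even k. *)
have -> : \sum_(x <- X) Num.sg x
    = \sum_(x <- X) (((0 < x)%R : nat)%:R * 2 - 1%:R).
  rewrite big_seq [RHS]big_seq; apply: eq_bigr => x xX.
  have : x != 0 by apply: contraNneq X0 => <-.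
  by case: sgrP.
rewrite sumrB -mulr_suml -!natr_sum sum1_size cardX.
have -> : (\sum_(x <- X) ((0 < x)%R : nat) = k./2)%N.
  by rewrite -pos card_fset_sum1 big_fset /= [RHS]big_mkcond.
by rewrite -{2}(even_halfK evk); lia.
Qed.

Lemma shiftable_block_prod (V X : {fset int}) (T : choiceType)
    (W Y : {fset T}) (g : T -> nat) v k :
  half_set v V -> {in W &, injective g} -> X `<=` V -> Y `<=` W ->
  ~~ odd k -> #|` X| = k -> \sum_(x <- X) x = 0 ->
  #|` [fset x in X | 0 < x]| = k./2 ->
  let Z := prod_block (fun x i => zshift v x (g i)) X Y in
  \sum_(z <- Z) z = 0 /\ #|` [fset z in Z | 0 < z]| = (k./2 * #|` Y|)%N.
Proof.
move=> /half_setP[bnd _ _] inj_g sXV sYW evk cardX sumX posX Z.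
have inj_f x y i j : x \in V -> y \in V -> i \in W -> j \in W ->
    zshift v x (g i) = zshift v y (g j) -> x = y /\ i = j.
  by move=> /bnd[x0 xv] /bnd[y0 yv] iW jW /zshift_inj[] // -> /inj_g ->.
have X0 x : x \in X -> x != 0 by move=> /(fsubsetP sXV)/bnd[].
split.
  rewrite (big_prod_block inj_f) //=.
  under eq_bigr => x _ do rewrite /zshift big_split /= -mulr_sumr.
  rewrite big_split -mulr_suml /= (sum_sgr_balanced evk) //; last first.
    by apply/negP => /X0 /eqP.
  (* The remaining double sum of x vanishes once X is summed first. *)
  by rewrite mul0r addr0 exchange_big big1.
(* As the shift preserves signs, the positive part of [Z] is the product of the positive part of [X]
   with [Y]. *)
rewrite -posX -(card_prod_block inj_f) //; last first.
  by apply: fsubset_trans sXV; apply/fsubsetP => x; rewrite !inE => /andP[].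
congr (#|` _|); apply/fsetP => z; apply/idP/prod_blockP.
- rewrite !inE => /andP[/prod_blockP[x [i [xX iY ->]]]] zpos.
  exists x, i; split=> //; rewrite !inE xX /=.
  by rewrite -sgr_gt0 -(sgr_zshift v (g i)) ?sgr_gt0 ?X0.
- move=> [x [i []]]; rewrite !inE => /andP[xX xpos] iY ->.
  rewrite -sgr_gt0 sgr_zshift ?X0 // sgr_gt0 xpos andbT.
  by apply/prod_blockP; exists x, i.
Qed.

(** Negation commutes with the shift and leaves the index alone, so choosing one of z and -z reduces
    to the same choice for x and -x in [V]. *)
Lemma half_set_prod (V : {fset int}) (T : choiceType) (W : {fset T}) v w :
  half_set v V -> #|` W| = w ->
  half_set (v * w) (prod_block (fun x i => zshift v x (index i W)) V W).
Proof.
move=> /half_setP[bnd dis cov] cardW; apply/half_setP; split.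
- move=> _ /prod_blockP[x [i [/bnd[x0 xv] iW ->]]].
  rewrite -sgr_eq0 sgr_zshift // sgr_eq0 x0 normr_zshift //; split=> //.
  (* The index is at most w - 1, which bounds the absolute value by v + v(w - 1) = vw. *)
  have : (index i W < w)%N by rewrite -cardW index_mem.
  by nia.
- move=> _ /prod_blockP[x [i [xV iW ->]]].
  apply/prod_blockP => -[y [j [yV jW]]]; rewrite -zshiftN.
  have [[x0 xv] [y0 yv]] := (bnd x xV, bnd y yV).
  move=> /zshift_inj[]; rewrite ?oppr_eq0 ?normrN // => eqy _.
  by have := dis x xV; rewrite eqy yV.
- move=> z z0 /(zshift_surj z0)[x [m [x0 xv mw ->]]].
  have [i [iW <-]] : exists i, i \in W /\ index i W = m.
    rewrite -cardW in mw.
    have [i0 _] : exists i0, i0 \in W by apply/fset0Pn; rewrite -cardfs_gt0; lia.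
    by exists (nth i0 W m); rewrite mem_nth ?index_uniq ?fset_uniq.
  rewrite -zshiftN; case/orP: (cov x x0 xv) => xV; apply/orP; [left|right].
    by apply/prod_blockP; exists x, i.
  by apply/prod_blockP; exists (- x), i.
Qed.

Theorem theorem2p1 (v k r w n : nat)
    (hv : (0 < v)%N) (hk : (0 < k)%N) (hr : (0 < r)%N)
    (hw : (0 < w)%N) (hn : (0 < n)%N)
    (hHeffter : exists (V : {fset int}) (B : seq {fset int}),
       shiftable_heffter_space V B v k r)
    (hSpace : exists (T : choiceType) (W : {fset T}) (C : seq {fset T}),
       is_space W C w n r) :
  exists (V' : {fset int}) (B' : seq {fset int}),
    shiftable_heffter_space V' B' (v * w)%N (k * n)%N r.
Proof.
have [V [B [[spaceV halfV sumB] evk posB]]] := hHeffter.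
have [T [W [C spaceW]]] := hSpace.
have [Ps resP permB] := space_resolution hv spaceV.
have [Qs resQ _] := space_resolution hw spaceW.
pose f x i := zshift v x (index i W).
have inj_index : {in W &, injective (index^~ W)}.
  by move=> i j iW jW; apply: index_inj.
have inj_f x y i j : x \in V -> y \in V -> i \in W -> j \in W ->
    f x i = f y j -> x = y /\ i = j.
  have /half_setP[bnd _ _] := halfV.
  by move=> /bnd[x0 xv] /bnd[y0 yv] iW jW /zshift_inj[] // -> /inj_index ->.
exists (prod_block f V W).
exists (flatten [seq enum_fset P | P <- prod_resolution f Ps Qs]).
have [_ sizeP partP cardP _] := resP; have [cardW sizeQ partQ cardQ _] := resQ.
have block Z :
    Z \in flatten [seq enum_fset P | P <- prod_resolution f Ps Qs] ->
    \sum_(z <- Z) z = 0 /\ #|` [fset z in Z | 0 < z]| = (k * n)./2.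
  move=> /mem_flatten_enum[_ /mapP[PQ PQin ->]].
  have [PPs QQs] : PQ.1 \in Ps /\ PQ.2 \in Qs.
    by apply: mem_zip PQin; rewrite sizeP.
  move=> /prod_classP[X [Y [XP YQ ->]]].
  have /is_partitionP[/(_ X XP)[sXV _] _ _] := partP _ PPs.
  have /is_partitionP[/(_ Y YQ)[sYW _] _ _] := partQ _ QQs.
  have XB : X \in B.
    by rewrite (perm_mem permB); apply/mem_flatten_enum; exists PQ.1.
  (* Evenness of [k] lets the halving act on [k] alone, whatever the parity of [n]. *)
  have -> : ((k * n)./2 = k./2 * #|` Y|)%N.
    by rewrite (cardQ _ _ QQs YQ) -{1}(even_halfK evk) -doubleMl doubleK.
  exact: (shiftable_block_prod halfV inj_index sXV sYW evk
            (cardP _ _ PPs XP) (sumB X XB) (posB X XB)).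
split; last 2 first.
- by rewrite oddM negb_and evk.
- by move=> Z /block[].
split; last by move=> Z /block[].
- exact/resolution_space/resolution_prod.
- exact: half_set_prod.
Qed.
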